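(* Let $k$ be a field, $X$ a well-ordered set, and let $AC(X)$ be the free anti-commutative $k$-algebra on $X$ with $k$-basis the set $N$ of normal words, ordered by the deg-lex order $<$. Let $$S_0=\{(uv)w-(uw)v-u(vw)\ \mid\ u,v,w \text{ are Hall words and } u>v>w\}\subset AC(X),$$ where the products are taken in $AC(X)$. Then $S_0$ is a Gröbner-Shirshov basis in $AC(X)$.
   Context: Let $k$ be a field and $X=\{x_i\mid i\in I\}$ a well-ordered set ($x_i>x_j$ iff $i>j$). $X^*$ is the set of associative words in $X$ (including the empty word), $X^{**}$ the set of non-associative (bracketed) words; $|u|$ is the length of a word. Normal words and their order (deg-lex order) are defined by induction on length. Each $x_i$ is a normal word, ordered as in $X$. A non-associative word $((v)(w))$ of length $n>1$ is normal iff $(v)=[v]$ and $(w)=[w]$ are normal words and $[v]>[w]$. For normal words $[u],[v]$: if $|u|<|v|$ then $[u]<[v]$; if $|u|=|v|>1$, $[u]=[[u_1][u_2]]$, $[v]=[[v_1][v_2]]$, then $[u]<[v]$ iff $[u_1]<[v_1]$, or $[u_1]=[v_1]$ and $[u_2]<[v_2]$. $N$ is the set of normal words; $<$ is a well order on $N$. $AC(X)$ is the $k$-vector space with basis $N$ and bilinear product given on $N$ by $[u][v]=[[u][v]]$ if $[u]>[v]$, $[u][v]=-[[v][u]]$ if $[u]<[v]$, and $[u][v]=0$ if $[u]=[v]$. Every non-associative word, evaluated in $AC(X)$, equals $\pm$ a normal word or $0$. For $0\ne f\in AC(X)$, $[\bar f]\in N$ is the largest normal word occurring in $f$ with nonzero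 coefficient; $f$ is monic if that coefficient is $1$. Let $S\subset AC(X)$ be a set of monic polynomials. For $s\in S$, $s$-words ($S$-words) are defined inductively: $s$ is an $S$-word; if $(u)_s$ is an $S$-word and $(v)$ is a non-associative word then $(u)_s(v)$ and $(v)(u)_s$ are $S$-words. (So an $s$-word is a bracketed word with one marked place filled by $s$; it also denotes its value in $AC(X)$.) It is a normal $S$-word (normal $s$-word) if the bracketed word $(u)_{[\bar s]}$ obtained by putting $[\bar s]$ in the place of $s$ is a normal word. A normal $s$-word is written $[asb]$, where $a,b\in X^*$ are the words to the left and right of $s$, and the corresponding normal word is written $[a[\bar s]b]$; it is the leading word of $[asb]$. If $f,g$ are monic and $[\bar f]=[a[\bar g]b]$ for some $a,b\in X^*$ with $[agb]$ a normal $g$-word, then with $[w]=[\bar f]$ the composition (of inclusion) is $(f,g)_{[w]}=f-[agb]$. It is trivial modulo $(S,[w])$ if $(f,g)_{[w]}=\sum_i\alpha_i[a_is_ib_i]$ (finite sum) with $\alpha_i\in k$, $a_i,b_i\in X^*$, $s_i\in S$, $[a_is_ib_i]$ normal $S$-words and $[a_i[\bar{s_i}]b_i]<[w]$. $S$ is a Gröbner-Shirshov basis if every composition $(f,g)_{[w]}$ with $f,g\in S$ is trivial modulo $(S,[w])$. Hall words are defined by induction on length: every $x_i\in X$ is a Hall word; a normal word $[[v][w]]$ is a Hall word iff (a) both $[v]$ and $[w]$ are Hall words and (b) if $[v]=[[v_1][v_2]]$ then $[v_2]\le [w]$. *)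

(* Defs.v *)
From HB Require Import structures.
From mathcomp Require Import all_boot all_order all_algebra.
From mathcomp Require Import finmap.
From mathcomp.multinomials Require Import monalg.

Set Implicit Arguments.
Unset Strict Implicit.
Unset Printing Implicit Defensive.

Import Order.TTheory GRing.Theory.
Local Open Scope ring_scope.

Inductive naword (X : Type) :=
  | Var of X
  | Br of naword X & naword X.

Section NawordChoice.
Variable X : Type.

Fixpoint naword_encode (w : naword X) : GenTree.tree X :=
  match w with
  | Var x => GenTree.Leaf x
  | Br u v => GenTree.Node 0 [:: naword_encode u; naword_encode v]
  end.

Fixpoint naword_decode (t : GenTree.tree X) : option (naword X) :=
  match t with
  | GenTree.Leaf x => Some (Var x)
  | GenTree.Node _ [:: t1; t2] =>
      if (naword_decode t1, naword_decode t2) is (Some u, Some v)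
      then Some (Br u v) else None
  | _ => None
  end.

Lemma naword_encodeK : pcancel naword_encode naword_decode.
Proof. by elim=> [x|u IHu v IHv] //=; rewrite IHu IHv. Qed.

End NawordChoice.

HB.instance Definition _ (X : choiceType) :=
  Choice.copy (naword X) (pcan_type (@naword_encodeK X)).

Fixpoint wlen (X : Type) (w : naword X) : nat :=
  if w is Br u v then (wlen u + wlen v)%N else 1%N.

Lemma wlen_gt0 (X : Type) (w : naword X) : (0 < wlen w)%N.
Proof. by elim: w => //= u IHu v _; rewrite addn_gt0 IHu. Qed.

Lemma wlen_Br_gt1 (X : Type) (u v : naword X) : (1 < wlen u + wlen v)%N.
Proof. exact: leq_add (wlen_gt0 u) (wlen_gt0 v). Qed.

(* The inductive formula for the order on normal words makes sense, and is a
   total order, on all bracketed words; normal words carry its restriction. *)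
Section DegLex.
Context {disp : Order.disp_t} {X : orderType disp}.
Implicit Types u v w : naword X.

Fixpoint deglex_lt u v : bool :=
  (wlen u < wlen v)%N ||
  (wlen u == wlen v) &&
  match u, v with
  | Var x, Var y => (x < y)%O
  | Br u1 u2, Br v1 v2 => deglex_lt u1 v1 || (u1 == v1) && deglex_lt u2 v2
  | _, _ => false
  end.

Lemma deglex_irr : irreflexive deglex_lt.
Proof.
elim=> [x|u IHu v IHv] /=; first by rewrite ltxx.
by rewrite ltnn IHu IHv !andbF.
Qed.

Lemma deglex_trans : transitive deglex_lt.
Proof.
move=> v u w; elim: u v w => [x|u1 IH1 u2 IH2] [y|v1 v2] [z|w1 w2] /=;
  rewrite ?wlen_Br_gt1 //= ?andbF ?orbF.
- exact: lt_trans.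
- by move=> _ /ltnW; rewrite leqNgt wlen_Br_gt1.
- by move=> /ltnW; rewrite leqNgt wlen_Br_gt1.
- by move=> _ /ltnW; rewrite leqNgt wlen_Br_gt1.
case/orP=> [h1|/andP[/eqP e1 h1]] /orP[h2|/andP[/eqP e2 h2]].
- by rewrite (ltn_trans h1 h2).
- by rewrite -e2 h1.
- by rewrite e1 h2.
rewrite e1 e2 ltnn eqxx /=.
case/orP: h1 => [h1|/andP[/eqP-> h1]]; case/orP: h2 => [h2|/andP[/eqP e h2]].
- by rewrite (IH1 _ _ h1 h2).
- by rewrite -e h1.
- by rewrite h2.
by rewrite e eqxx (IH2 _ _ h1 h2) orbT.
Qed.

Lemma deglex_total u v : u != v -> deglex_lt u v || deglex_lt v u.
Proof.
elim: u v => [x|u1 IH1 u2 IH2] [y|v1 v2] /=; rewrite ?wlen_Br_gt1 ?orbT //.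
  by move=> nxy; rewrite -neq_lt; apply: contra nxy => /eqP->.
move=> nuv; case: ltngtP => //= _.
have [e1|n1] := eqVneq u1 v1; last first.
  by case/orP: (IH1 _ n1) => ->; rewrite ?orbT.
have n2 : u2 != v2 by apply: contra nuv => /eqP->; rewrite e1.
by case/orP: (IH2 _ n2) => ->; rewrite !orbT.
Qed.

Definition deglex_le u v : bool := (u == v) || deglex_lt u v.

End DegLex.

Fact deglex_display (disp : Order.disp_t) : Order.disp_t.
Proof. exact: disp. Qed.

HB.instance Definition _ (disp : Order.disp_t) (X : orderType disp) :=
  Order.LtOrder.Build (deglex_display disp) (naword X)
    (fun _ _ => erefl) (fun _ _ => erefl) (fun _ _ => erefl)
    (@deglex_irr disp X) (@deglex_trans disp X) (@deglex_total disp X).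

Fixpoint normal (disp : Order.disp_t) (X : orderType disp) (w : naword X) : bool :=
  if w is Br u v then [&& normal u, normal v & (u > v)%O] else true.

Record nword (disp : Order.disp_t) (X : orderType disp) :=
  NWord { nword_val :> naword X; nword_valP : normal nword_val }.

Section NwordOrder.
Variables (disp : Order.disp_t) (X : orderType disp).
HB.instance Definition _ := [isSub for @nword_val disp X].
HB.instance Definition _ := [Choice of nword X by <:].
HB.instance Definition _ :=
  [SubChoice_isSubOrder of nword X by <: with (deglex_display disp)].
End NwordOrder.

Section HallWords.
Context {disp : Order.disp_t} {X : orderType disp}.

Fixpoint hall (w : naword X) : bool :=
  if w is Br u v then
    [&& normal w, hall u, hall v & if u is Br _ u2 then (u2 <= v)%O else true]
  else true.

End HallWords.

Notation acalg k X := {malg k[nword X]}.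

Section FreeAntiCommutative.
Context {k : fieldType} {disp : Order.disp_t} {X : orderType disp}.

(* The default value [u] is only reached when [u <= v]. *)
Definition nbr (u v : nword X) : nword X := insubd u (Br (val u) (val v)).

Lemma val_nbr (u v : nword X) : (u > v)%O -> val (nbr u v) = Br (val u) (val v).
Proof. by move=> uv; rewrite insubdK // unfold_in /= !valP. Qed.

Definition nmul (u v : nword X) : acalg k X :=
  if (u > v)%O then << nbr u v >>
  else if (u < v)%O then - << nbr v u >>
  else 0.

Definition acmul (f g : acalg k X) : acalg k X :=
  \sum_(u <- msupp f) \sum_(v <- msupp g) (f@_u * g@_v) *: nmul u v.

Definition acvar (x : X) : acalg k X := << @NWord disp X (Var x) isT >>.

Fixpoint aceval (w : naword X) : acalg k X :=
  match w with
  | Var x => acvar x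
  | Br u v => acmul (aceval u) (aceval v)
  end.

Definition leading (f : acalg k X) (w : nword X) : Prop :=
  w \in msupp f /\ forall v : nword X, v \in msupp f -> (v <= w)%O.

Definition monic (f : acalg k X) : Prop :=
  exists w : nword X, leading f w /\ f@_w = 1.

End FreeAntiCommutative.

(* Bracketed words with one marked place.  An s-word [asb] is given by such a
   context [c] and the element [s]; [a] and [b] are the words read off [c] to
   the left and to the right of the mark, so quantifying over the s-words
   written [asb] amounts to quantifying over [c]. *)
Inductive ctx (X : Type) :=
  | Hole
  | CtxL of ctx X & naword X
  | CtxR of naword X & ctx X.

Fixpoint plug (X : Type) (c : ctx X) (w : naword X) : naword X :=
  match c with
  | Hole => w
  | CtxL c v => Br (plug c w) v
  | CtxR v c => Br v (plug c w)
  end.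

Section GroebnerShirshov.
Context {k : fieldType} {disp : Order.disp_t} {X : orderType disp}.

Fixpoint sword (c : ctx X) (s : acalg k X) : acalg k X :=
  match c with
  | Hole => s
  | CtxL c v => acmul (sword c s) (aceval v)
  | CtxR v c => acmul (aceval v) (sword c s)
  end.

(* [asb] is a normal s-word and w = [a[\bar s]b]. *)
Definition normal_sword (c : ctx X) (s : acalg k X) (w : nword X) : Prop :=
  exists ls : nword X, leading s ls /\ plug c (val ls) = val w.

(* h is the composition (f,g)_[w] formed with the normal g-word [agb]. *)
Definition composition (f g : acalg k X) (w : nword X) (h : acalg k X) : Prop :=
  leading f w /\
  exists c : ctx X, normal_sword c g w /\ h = f - sword c g.

Definition trivial_mod (S : acalg k X -> Prop) (w : nword X) (h : acalg k X) : Prop :=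
  exists (n : nat) (alpha : 'I_n -> k) (c : 'I_n -> ctx X) (s : 'I_n -> acalg k X),
    (forall i : 'I_n,
        S (s i) /\ exists v : nword X, normal_sword (c i) (s i) v /\ (v < w)%O) /\
    h = \sum_(i < n) alpha i *: sword (c i) (s i).

Definition groebner_shirshov_basis (S : acalg k X -> Prop) : Prop :=
  (forall s : acalg k X, S s -> monic s) /\
  (forall (f g : acalg k X) (w : nword X) (h : acalg k X),
      S f -> S g -> composition f g w h -> trivial_mod S w h).

End GroebnerShirshov.

Definition S0 (k : fieldType) (disp : Order.disp_t) (X : orderType disp)
    (f : acalg k X) : Prop :=
  exists u v w : nword X,
    [/\ hall (val u), hall (val v) & hall (val w)] /\
    (u > v)%O /\ (v > w)%O /\
    f = acmul (acmul << u >> << v >>) << w >>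
        - acmul (acmul << u >> << w >>) << v >>
        - acmul << u >> (acmul << v >> << w >>).

(* Main.v *)
From HB Require Import structures.
Require Import Defs.
From mathcomp Require Import all_boot all_order all_algebra.
From mathcomp Require Import finmap zify ring.
From mathcomp.multinomials Require Import monalg.

(** Write J f g h = (fg)h - (fh)g - f(gh) for the jacobian.  In an
    anti-commutative algebra it is alternating, and S0 consists of the
    J u v w with u > v > w Hall words; the leading word of such an element is
    [[uv]w].  Condition (b) in the definition of Hall words forbids exactly
    the subwords [[uv]w] with v > w.  This has two consequences.

    - A normal word that is not a Hall word contains the leading word of an
      element of S0 ([nonhall_sword]).  Rewriting along the well-order of the
      normal words, every normal word w is therefore a combination of Hall
      words <= w and of normal S0-words with leading word <= w
      ([hall_reducibleU]).
    - A Hall word contains no such leading word.  Hence [[uv]w] can contain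
      the leading word of an element of S0 only as a whole, where the
      composition is 0, or as its part [uv].  In the second case the word is
      [[[ab]c]d] with Hall words a > b > c > d, and the composition is
      J(ab, c, d) - J(a, b, c)d.

    What makes this composition trivial is an identity that holds in every
    anti-commutative algebra ([jacobian_overlap]):

      J(ab,c,d) - J(a,b,c)d = - J(cd,a,b) - J(ac,d,b) + J(bd,a,c)
                              - J(ad,b,c) - J(bc,a,d)
                              - J(a,b,d)c + J(a,c,d)b - J(b,c,d)a.

    All terms on the right are smaller than [[[ab]c]d].  The last three are
    elements of S0 times a word ([sspan_jacobian_mul]).  In a term J(pq, r, s)
    the word [pq] need not be a Hall word, but [pq] < [ab], so it reduces to
    Hall words h < [ab] and normal S0-words t with leading word < [ab].  Each
    J(h, r, s) is zero or, up to sign, an element of S0, because J is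
    alternating; each J(t, r, s) consists of products of a normal S0-word with
    normal words, and such a product is again a combination of normal S0-words
    ([sspan_mul]).  That the results stay below [[[ab]c]d] only needs that all
    factors are < [ab] and a few inequalities between lengths
    ([sspan_jacobian_reducible]). *)

Set Implicit Arguments.
Unset Strict Implicit.
Unset Printing Implicit Defensive.

Import Order.TTheory GRing.Theory.
Local Open Scope ring_scope.

(** * The deg-lex order *)

Section Order.
Context {disp : Order.disp_t} {X : orderType disp}.
Implicit Types u v w : naword X.

Lemma naword_ltE u v : (u < v)%O = deglex_lt u v.
Proof. by []. Qed.

Lemma Br_ltE u1 u2 v1 v2 :
  (Br u1 u2 < Br v1 v2)%O =
    (wlen u1 + wlen u2 < wlen v1 + wlen v2)%N ||
    (wlen u1 + wlen u2 == wlen v1 + wlen v2)%N &&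
      ((u1 < v1)%O || (u1 == v1) && (u2 < v2)%O).
Proof. by []. Qed.

Lemma wlen_lt u v : (wlen u < wlen v)%N -> (u < v)%O.
Proof. by rewrite naword_ltE; case: u => [x|u1 u2] /= ->. Qed.

Lemma leq_wlen u v : (u <= v)%O -> (wlen u <= wlen v)%N.
Proof. by apply: contraTT; rewrite -ltnNge -ltNge; apply: wlen_lt. Qed.

Lemma Br_lt u1 u2 v1 v2 :
    (wlen u1 + wlen u2 <= wlen v1 + wlen v2)%N ->
    (u1 < v1)%O || (u1 == v1) && (u2 < v2)%O ->
  (Br u1 u2 < Br v1 v2)%O.
Proof. by rewrite Br_ltE => le ->; rewrite andbT orbC -leq_eqVlt. Qed.

Lemma lt_Brl u v : (u < Br u v)%O.
Proof. by apply: wlen_lt => /=; have := wlen_gt0 v; lia. Qed.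

(** Strong induction on the length.  Among the words of one length > 1, the
    order is the lexicographic order on pairs of shorter words, which are
    accessible by induction. *)
Lemma naword_wf :
  well_founded (fun x y : X => (x < y)%O) ->
  well_founded (fun u v : naword X => (u < v)%O).
Proof.
move=> X_wf w; have [n le_wn] := ubnP (wlen w).
elim: n w le_wn => [//|n IHn [x _|u v]].
  elim: {x}(X_wf x) => x _ IHx; constructor=> -[y|y1 y2] lt_yx.
    exact: IHx.
  by have := leq_wlen (ltW lt_yx); rewrite /= leqNgt wlen_Br_gt1.
move=> le_n; have [] : (wlen u < n)%N /\ (wlen v < n)%N.
  by have := wlen_gt0 u; have := wlen_gt0 v; move: le_n => /=; lia.
move=> /IHn acc_u; elim: acc_u v le_n => {}u _ IHu v le_n /IHn acc_v.
elim: acc_v le_n => {}v _ IHv le_n; constructor=> y lt_y.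
have [lt_wl|] := ltnP (wlen y) (wlen (Br u v)).
  by apply: IHn; apply: leq_trans lt_wl _.
move=> ge_wl; have le_wl := leq_wlen (ltW lt_y).
have e_wl : wlen y = wlen (Br u v) by apply/eqP; rewrite eqn_leq le_wl.
case: y lt_y e_wl {ge_wl le_wl} => [y|y1 y2].
  by move=> _ /= e; have := wlen_Br_gt1 u v; rewrite -e.
rewrite Br_ltE => + /= e_wl; rewrite e_wl ltnn eqxx /=.
have lt_y2 : (wlen y2 < n)%N.
  by have := wlen_gt0 y1; move: le_n => /=; lia.
case/orP=> [lt_y1|/andP[/eqP e_y1 lt_v]].
  by apply: IHu => //=; rewrite e_wl.
by rewrite e_y1 in e_wl *; apply: IHv => //=; rewrite e_wl.
Qed.
End Order.

(** The inequalities between lengths below follow from such inequalities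
    alone.  Everything else is dropped first: the hypotheses on words and on
    algebra elements are expensive to preprocess. *)
Ltac len_lia :=
  repeat match goal with
  | H : ?T |- _ =>
      lazymatch T with
      | is_true (leq _ _) => fail
      | @eq nat _ _ => fail
      | _ => clear H
      end
  end; lia.

Section NormalWords.
Context {disp : Order.disp_t} {X : orderType disp}.
Implicit Types u v w : nword X.

Definition nlen w := wlen (val w).

Lemma leq_nlen u v : (u <= v)%O -> (nlen u <= nlen v)%N.
Proof. by rewrite leEsub; apply: leq_wlen. Qed.

Lemma nlen_nbr u v : (v < u)%O -> nlen (nbr u v) = (nlen u + nlen v)%N.
Proof. by move=> lt; rewrite /nlen val_nbr. Qed.

(** An inequality between the lengths suffices, because a strictly shorter word
    is smaller anyway. *)
Lemma nbr_lt u1 u2 v1 v2 :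
    (u2 < u1)%O -> (v2 < v1)%O ->
    (nlen u1 + nlen u2 <= nlen v1 + nlen v2)%N ->
    (u1 < v1)%O || (u1 == v1) && (u2 < v2)%O ->
  (nbr u1 u2 < nbr v1 v2)%O.
Proof.
move=> ltu ltv le lt; rewrite ltEsub !val_nbr //.
by apply: Br_lt => //; rewrite -!ltEsub val_eqE.
Qed.

Lemma nbr_gtl u v : (v < u)%O -> (u < nbr u v)%O.
Proof. by move=> lt; rewrite ltEsub val_nbr // lt_Brl. Qed.

Lemma nword_wf :
  well_founded (fun x y : X => (x < y)%O) ->
  well_founded (fun u v : nword X => (u < v)%O).
Proof.
move=> X_wf w; move e: (val w) => x.
elim: {x}(naword_wf X_wf x) w e => x _ IH w e.
by constructor=> v; rewrite ltEsub e => lt; apply: IH lt _ erefl.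
Qed.

End NormalWords.

(** * The product of the free anti-commutative algebra *)

(** Basis elements and the product are locked, so that comparing two different
    basis elements or products never unfolds the finite sums behind them. *)
HB.lock Definition basisw (k : fieldType) (disp : Order.disp_t)
  (X : orderType disp) (w : nword X) : acalg k X := << w >>.

Notation "''b_' w" := (basisw _ w) (at level 8, w at level 2, format "''b_' w").

HB.lock Definition acprod (k : fieldType) (disp : Order.disp_t)
  (X : orderType disp) (f g : acalg k X) : acalg k X := acmul f g.

Notation "f ** g" := (acprod f g) (at level 29, left associativity).

Section Product.
Context {k : fieldType} {disp : Order.disp_t} {X : orderType disp}.
Implicit Types (u v w : nword X) (f g h : acalg k X) (a : k).

Lemma acmulE f g : acmul f g = f ** g.
Proof. by rewrite acprod.unlock. Qed.

Lemma msupp_basisw w : msupp (basisw k w) = [fset w]%fset.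
Proof. by rewrite basisw.unlock msuppU oner_eq0. Qed.

Lemma mcoeff_basisw w v : (basisw k w)@_v = (w == v)%:R.
Proof. by rewrite basisw.unlock; apply: mcoeffU. Qed.

Lemma mcoeff_basisww w : (basisw k w)@_w = 1 :> k.
Proof. by rewrite mcoeff_basisw eqxx. Qed.

Lemma acalg_ind f (Q : acalg k X -> Prop) :
    Q 0 ->
    (forall a w g, w \in msupp f -> Q g -> Q (a *: 'b_w + g)) ->
  Q f.
Proof.
move=> Q0 QD; rewrite [X in Q X]monalgE big_seq.
apply: (big_rec Q) => // w g wf Qg.
have -> : << f@_w *g w >> = f@_w *: 'b_w.
  apply/malgP => v; rewrite mcoeffU mcoeffZ mcoeff_basisw mulr_natr.
  reflexivity.
exact: QD.
Qed.

Lemma sum_msupp (V : lmodType k) (F : nword X -> V) f (d : {fset nword X}) :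
    (msupp f `<=` d)%fset ->
  \sum_(u <- msupp f) f@_u *: F u = \sum_(u <- d) f@_u *: F u.
Proof.
move=> sub; apply: big_fset_incl => // u _ /mcoeff_outdom ->.
by rewrite scale0r.
Qed.

Lemma sum_msupp_linear (V : lmodType k) (F : nword X -> V) a f g :
  \sum_(u <- msupp (a *: f + g)) (a *: f + g)@_u *: F u =
  a *: (\sum_(u <- msupp f) f@_u *: F u) + \sum_(u <- msupp g) g@_u *: F u.
Proof.
pose d := (msupp f `|` msupp g)%fset.
rewrite (@sum_msupp _ _ f d) ?fsubsetUl // (@sum_msupp _ _ g d) ?fsubsetUr //.
rewrite (@sum_msupp _ _ _ d); last first.
  by apply: fsubset_trans (msuppD_le _ _) _; apply/fsetSU/msuppZ_le.
rewrite scaler_sumr -big_split; apply: eq_bigr => u _.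
by rewrite mcoeffD mcoeffZ scalerDl scalerA.
Qed.

Lemma acprodP a f g h : (a *: f + g) ** h = a *: f ** h + g ** h.
Proof.
pose F u := \sum_(v <- msupp h) h@_v *: nmul (k := k) u v.
have E e : e ** h = \sum_(u <- msupp e) e@_u *: F u.
  rewrite acprod.unlock.
  apply: eq_bigr => u _; rewrite scaler_sumr.
  by apply: eq_bigr => v _; rewrite scalerA.
by rewrite !E sum_msupp_linear.
Qed.

Lemma acprod0l f : 0 ** f = 0.
Proof. by rewrite acprod.unlock /acmul msupp0 big_seq_fset0. Qed.

Lemma acprodDl f g h : (f + g) ** h = f ** h + g ** h.
Proof. by rewrite -[f]scale1r acprodP !scale1r. Qed.

Lemma acprodZl a f h : (a *: f) ** h = a *: f ** h.
Proof. by rewrite -[a *: f]addr0 acprodP acprod0l addr0. Qed.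

Lemma acprodNl f h : (- f) ** h = - f ** h.
Proof. by rewrite -scaleN1r acprodZl scaleN1r. Qed.

Lemma nmulC u v : nmul u v = - nmul v u :> acalg k X.
Proof. by rewrite /nmul; case: ltgtP; rewrite ?opprK ?oppr0. Qed.

Lemma acprodC f g : f ** g = - g ** f.
Proof.
rewrite acprod.unlock /acmul exchange_big -sumrN; apply: eq_bigr => v _.
rewrite -sumrN; apply: eq_bigr => u _.
by rewrite nmulC scalerN mulrC.
Qed.

Lemma acprodUU u v : 'b_u ** 'b_v = nmul u v :> acalg k X.
Proof.
rewrite acprod.unlock /acmul !msupp_basisw !big_seq_fset1.
by rewrite !mcoeff_basisww mul1r scale1r.
Qed.

Lemma acprodDr f g h : f ** (g + h) = f ** g + f ** h.
Proof. by rewrite acprodC acprodDl opprD -(acprodC f g) -(acprodC f h). Qed.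

Lemma acprodZr a f h : f ** (a *: h) = a *: f ** h.
Proof. by rewrite acprodC acprodZl -scalerN -acprodC. Qed.

Lemma acprodNr f h : f ** (- h) = - f ** h.
Proof. by rewrite acprodC acprodNl -acprodC. Qed.

Lemma acprod0r f : f ** 0 = 0.
Proof. by rewrite acprodC acprod0l oppr0. Qed.

(** In characteristic 2 this is stronger than [acprodC]; it holds because it
    holds on the basis and the mixed terms cancel in pairs. *)
Lemma acprodff f : f ** f = 0.
Proof.
apply: (@acalg_ind f (fun g => g ** g = 0)); first exact: acprod0l.
move=> a w g _ gg; rewrite acprodDl !acprodDr gg addr0.
rewrite (acprodC g) addrK acprodZl acprodZr acprodUU /nmul ltxx.
by rewrite !scaler0.
Qed.

Lemma nmul_gt u v : (v < u)%O -> nmul u v = 'b_(nbr u v) :> acalg k X.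
Proof. by rewrite /nmul basisw.unlock => ->. Qed.

Lemma aceval_normal w : aceval (val w) = 'b_w :> acalg k X.
Proof.
case: w => w /= w_n; elim: w w_n => [x|u IHu v IHv] w_n.
  by rewrite /= /acvar basisw.unlock; congr (<< _ >>); apply: val_inj.
have /and3P[u_n v_n lt_vu] := w_n.
rewrite /= (IHu u_n) (IHv v_n) acmulE acprodUU nmul_gt ?ltEsub //.
by congr (basisw _ _); apply: val_inj; rewrite val_nbr ?ltEsub.
Qed.

End Product.

(** * Supports and leading words *)

Section LeadingWords.
Context {k : fieldType} {disp : Order.disp_t} {X : orderType disp}.
Implicit Types (u v w : nword X) (f g h s : acalg k X) (a : k).
Implicit Types (P Q : nword X -> Prop).

Definition supp_in P f := forall w, w \in msupp f -> P w.

Lemma supp_in0 P : supp_in P 0.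
Proof. by move=> w; rewrite msupp0 in_fset0. Qed.

Lemma supp_inU P w : P w -> supp_in P 'b_w.
Proof. by move=> Pw v; rewrite msupp_basisw in_fset1 => /eqP->. Qed.

Lemma supp_inD P f g : supp_in P f -> supp_in P g -> supp_in P (f + g).
Proof.
move=> Pf Pg w /(fsubsetP (msuppD_le _ _)).
by rewrite in_fsetU => /orP[/Pf|/Pg].
Qed.

Lemma supp_inZ P a f : supp_in P f -> supp_in P (a *: f).
Proof. by move=> Pf w /(fsubsetP (msuppZ_le _ _)) /Pf. Qed.

Lemma supp_inN P f : supp_in P f -> supp_in P (- f).
Proof. by move=> Pf w; rewrite msuppN => /Pf. Qed.

Lemma supp_in_mull P Q f v :
    supp_in P f -> (forall u, P u -> supp_in Q (nmul u v)) ->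
  supp_in Q (f ** 'b_v).
Proof.
move=> Pf PQ.
apply: (@acalg_ind _ _ _ f (fun g => supp_in Q (g ** 'b_v))).
  by rewrite acprod0l; apply: supp_in0.
move=> a w g wf IH; rewrite acprodP acprodUU; apply: (supp_inD _ IH).
by apply: supp_inZ; apply: PQ; apply: Pf.
Qed.

(** A reformulation of [f] being monic with leading word [w] that is compatible
    with linear arguments: [f] is [w] plus a combination of smaller words. *)
Definition monic_at f w := supp_in (fun v => (v < w)%O) (f - 'b_w).

Lemma leading_monic_at f w : leading f w -> f@_w = 1 -> monic_at f w.
Proof.
move=> [_ f_le] fw v; rewrite -mcoeff_neq0 mcoeffB mcoeff_basisw.
have [<-|neq] := eqVneq w v; first by rewrite fw subrr eqxx.
by rewrite subr0 mcoeff_neq0 lt_neqAle eq_sym neq => /f_le.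
Qed.

Lemma leading_uniq f v w : leading f v -> leading f w -> v = w.
Proof. by move=> [fv le_v] [fw le_w]; apply/le_anti; rewrite le_v // le_w. Qed.

Lemma monic_atP f w : monic_at f w -> leading f w /\ f@_w = 1.
Proof.
move=> fw; have fw1 : f@_w = 1.
  apply/eqP; rewrite -subr_eq0; apply/negPn/negP => neq.
  suff /fw : w \in msupp (f - 'b_w) by rewrite ltxx.
  by rewrite -mcoeff_neq0 mcoeffB mcoeff_basisww.
split=> //; split=> [|v fv]; first by rewrite -mcoeff_neq0 fw1 oner_eq0.
have [->//|neq] := eqVneq v w; apply/ltW/fw.
rewrite -mcoeff_neq0 mcoeffB mcoeff_basisw (eq_sym w) (negPf neq) subr0.
by rewrite mcoeff_neq0.
Qed.

(** Whichever of [uv] and [vu] is the normal word, it is not longer than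
    [[w1 w2]] and its first part is smaller than [w1]. *)
Lemma nmul_lt u v w1 w2 :
    (u < w1)%O -> (v < w1)%O -> (w2 < w1)%O ->
    (nlen u + nlen v <= nlen w1 + nlen w2)%N ->
  supp_in (fun w => (w < nbr w1 w2)%O /\ nlen w = nlen u + nlen v)%N
    (nmul u v : acalg k X).
Proof.
move=> lt_u lt_v lt_w le; case: (ltgtP u v) => [lt|lt|->].
- rewrite nmulC nmul_gt //; apply: supp_inN; apply: supp_inU.
  rewrite nlen_nbr // addnC; split=> //.
  by apply: nbr_lt; rewrite ?lt_v // addnC.
- rewrite nmul_gt //; apply: supp_inU; rewrite nlen_nbr //; split=> //.
  by apply: nbr_lt; rewrite ?lt_u.
by rewrite /nmul ltxx; apply: supp_in0.
Qed.

Lemma sub_supp_in P Q f : (forall w, P w -> Q w) -> supp_in P f -> supp_in Q f.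
Proof. by move=> PQ Pf w /Pf/PQ. Qed.

Lemma monic_at_mull f u v :
  (v < u)%O -> monic_at f u -> monic_at (f ** 'b_v) (nbr u v).
Proof.
move=> lt fu; rewrite /monic_at -nmul_gt // -acprodUU -acprodNl -acprodDl.
apply: supp_in_mull fu _ => w lt_wu.
have le_wu := leq_nlen (ltW lt_wu).
by apply: sub_supp_in (nmul_lt lt_wu lt lt _) => [x []//|]; len_lia.
Qed.

Lemma monic_at_mulr f u v :
  (v < u)%O -> monic_at f v -> monic_at ('b_u ** f) (nbr u v).
Proof.
move=> lt fv; rewrite /monic_at -nmul_gt // -acprodUU -acprodNr -acprodDr.
rewrite acprodC; apply: supp_inN; apply: (supp_in_mull fv) => w lt_wv.
have lt_wu := lt_trans lt_wv lt.
rewrite nmulC nmul_gt //; apply: supp_inN; apply: supp_inU; apply: nbr_lt => //.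
  by rewrite leq_add2l leq_nlen // ltW.
by rewrite eqxx lt_wv orbT.
Qed.

Lemma swordL c s v : sword (CtxL c (val v)) s = sword c s ** 'b_v.
Proof. by rewrite /= acmulE aceval_normal. Qed.

Lemma swordR c s v : sword (CtxR (val v) c) s = 'b_v ** sword c s.
Proof. by rewrite /= acmulE aceval_normal. Qed.

(** Replacing a subword of a normal word by a smaller normal word gives zero or,
    up to sign, a smaller normal word; so the leading word of [s] stays leading
    at every level of the context. *)
Lemma sword_monic_at c s u w :
  monic_at s u -> plug c (val u) = val w -> monic_at (sword c s) w.
Proof.
move=> su; elim: c w => [|c IH v|v c IH] w e.
- by rewrite -(val_inj e).
- have := nword_valP w; rewrite -e => /and3P[c_n v_n lt].
  have -> : w = nbr (NWord c_n) (NWord v_n).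
    by apply: val_inj; rewrite val_nbr ?ltEsub.
  rewrite (swordL c s (NWord v_n)); apply: monic_at_mull; last exact: IH.
  by rewrite ltEsub.
have := nword_valP w; rewrite -e => /and3P[v_n c_n lt].
have -> : w = nbr (NWord v_n) (NWord c_n).
  by apply: val_inj; rewrite val_nbr ?ltEsub.
rewrite (swordR c s (NWord v_n)); apply: monic_at_mulr; last exact: IH.
by rewrite ltEsub.
Qed.

End LeadingWords.

(** * Combinations of normal S-words *)

Section NormalSwordSpan.
Context {k : fieldType} {disp : Order.disp_t} {X : orderType disp}.
Variable S : acalg k X -> Prop.
Hypothesis S_monic : forall s, S s -> Defs.monic s.
Implicit Types (u v w : nword X) (f g h s : acalg k X) (a : k) (c : ctx X).
Implicit Types (P Q : nword X -> Prop).

(** The span of the normal S-words whose leading word satisfies [P].  Triviality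
    modulo (S,[w]) is the case where [P] is being smaller than [w]; other
    bounds are needed for the intermediate factors of a product. *)
Inductive sspan P : acalg k X -> Prop :=
  | sspan0 : sspan P 0
  | sspan_cons a c s w f : S s -> normal_sword c s w -> P w -> sspan P f ->
      sspan P (a *: sword c s + f).

Lemma sspan_trivial_mod w f :
  sspan (fun v => (v < w)%O) f -> trivial_mod S w f.
Proof.
elim=> [|a c s v g Ss cs lt_vw _ [n [al [cc [ss [ok ->]]]]]].
  exists 0, (fun=> 0), (fun=> Hole X), (fun=> 0).
  by split=> [[]//|]; rewrite big_ord0.
pose cons T (x : T) (F : 'I_n -> T) (i : 'I_n.+1) :=
  if unlift ord0 i is Some j then F j else x.
have cons0 T x F : cons T x F ord0 = x by rewrite /cons unlift_none.
have consS T x F j : cons T x F (lift ord0 j) = F j by rewrite /cons liftK.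
exists n.+1, (cons _ a al), (cons _ c cc), (cons _ s ss); split.
  move=> i; case: (unliftP ord0 i) => [j ->|->]; first by rewrite !consS.
  by rewrite !cons0; split=> //; exists v.
apply: esym; apply: etrans; first by apply: big_ord_recl.
apply: f_equal2; first by rewrite !cons0.
by apply: eq_bigr => i _; rewrite !consS.
Qed.

Lemma sspanD P f g : sspan P f -> sspan P g -> sspan P (f + g).
Proof.
move=> Pf Pg; elim: Pf => [|a c s w h Ss cs Pw _ IH]; first by rewrite add0r.
by rewrite -addrA; apply: sspan_cons Ss cs Pw IH.
Qed.

Lemma sspanZ P a f : sspan P f -> sspan P (a *: f).
Proof.
elim=> [|b c s w h Ss cs Pw _ IH]; first by rewrite scaler0; apply: sspan0.
by rewrite scalerDr scalerA; apply: sspan_cons Ss cs Pw IH.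
Qed.

Lemma sspanN P f : sspan P f -> sspan P (- f).
Proof. by rewrite -scaleN1r; apply: sspanZ. Qed.

Lemma sspanB P f g : sspan P f -> sspan P g -> sspan P (f - g).
Proof. by move=> Pf Pg; apply: sspanD => //; apply: sspanN. Qed.

Lemma sspan1 P c s w : S s -> normal_sword c s w -> P w -> sspan P (sword c s).
Proof.
move=> Ss cs Pw; rewrite -[sword c s]scale1r -[_ *: _]addr0.
exact: sspan_cons Ss cs Pw (sspan0 P).
Qed.

Lemma sub_sspan P Q f : (forall w, P w -> Q w) -> sspan P f -> sspan Q f.
Proof.
move=> PQ; elim=> [|a c s w h Ss cs Pw _ IH]; first exact: sspan0.
by apply: sspan_cons Ss cs (PQ _ Pw) IH.
Qed.

Lemma normal_sword_monic_at c s w :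
  S s -> normal_sword c s w -> monic_at (sword c s) w.
Proof.
move=> /S_monic[u' [s_u' su'1]] [u [s_u e]].
apply: sword_monic_at e; apply: leading_monic_at => //.
by rewrite (leading_uniq s_u s_u').
Qed.

(** The length bound matters when [n] is less than the length of [w]: the
    shorter a factor is, the longer are the words by which it may be multiplied
    within a given total length. *)
Definition below w n v := (v < w)%O /\ (nlen v <= n)%N.

Lemma sspan_mulr P Q f g :
    supp_in P g -> (forall u, P u -> sspan Q (f ** 'b_u)) ->
  sspan Q (f ** g).
Proof.
move=> Pg PQ; apply: (@acalg_ind _ _ _ g (fun h => sspan Q (f ** h))).
  by rewrite acprod0r; apply: sspan0.
move=> a w h wg IH; rewrite acprodDr acprodZr; apply: (sspanD _ IH).
by apply: sspanZ; apply: PQ; apply: Pg.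
Qed.

(** If [v] is not the leading word [t] of the S-word, the product is a normal
    S-word up to sign.  If [v = t], it is not; but then the square of the S-word
    vanishes, so [v] can be replaced by [t] minus the S-word, a combination of
    words smaller than [t]. *)
Lemma sspan_sword_mul c s t w1 w2 v n :
    S s -> normal_sword c s t -> (w2 < w1)%O -> below w1 n t -> (v < w1)%O ->
    (n + nlen v <= nlen w1 + nlen w2)%N ->
  sspan (below (nbr w1 w2) (n + nlen v)) (sword c s ** 'b_v).
Proof.
move=> Ss cs lt_w [lt_t le_t] lt_v le.
have neqP u : (u < w1)%O -> (nlen u <= nlen v)%N -> u != t ->
  sspan (below (nbr w1 w2) (n + nlen v)) (sword c s ** 'b_u).
  move=> lt_u le_u; rewrite neq_lt => /orP[lt_ut|lt_tu].
    rewrite -swordL; apply: (@sspan1 _ (CtxL c (val u)) s (nbr t u)) => //.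
      case: cs => ls [s_ls e]; exists ls; split=> //=.
      by rewrite e val_nbr.
    split; last by rewrite nlen_nbr // leq_add.
    by apply: nbr_lt => //; rewrite ?lt_t //; len_lia.
  rewrite acprodC -swordR; apply: sspanN.
  apply: (@sspan1 _ (CtxR (val u) c) s (nbr u t)) => //.
    case: cs => ls [s_ls e]; exists ls; split=> //=.
    by rewrite e val_nbr.
  split; last by rewrite nlen_nbr // addnC leq_add.
  by apply: nbr_lt => //; rewrite ?lt_u //; len_lia.
have [e|] := eqVneq v t; last exact: neqP.
have -> : 'b_v = sword c s - (sword c s - 'b_t) by rewrite e subKr.
rewrite acprodDr acprodff add0r acprodNr; apply: sspanN.
apply: sspan_mulr (normal_sword_monic_at Ss cs) _ => u lt_ut.
apply: neqP; last by rewrite lt_eqF.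
  exact: lt_trans lt_ut lt_t.
by rewrite e leq_nlen // ltW.
Qed.

Lemma sspan_mul w1 w2 v n f :
    sspan (below w1 n) f -> (w2 < w1)%O -> (v < w1)%O ->
    (n + nlen v <= nlen w1 + nlen w2)%N ->
  sspan (below (nbr w1 w2) (n + nlen v)) (f ** 'b_v).
Proof.
move=> Pf lt_w lt_v le; elim: Pf => [|a c s t h Ss cs Pt _ IH].
  by rewrite acprod0l; apply: sspan0.
rewrite acprodP; apply: (sspanD _ IH).
by apply/sspanZ/(sspan_sword_mul Ss cs lt_w Pt).
Qed.

End NormalSwordSpan.

(** * The jacobian *)

Section Jacobian.
Context {k : fieldType} {disp : Order.disp_t} {X : orderType disp}.
Implicit Types (u v w : nword X) (f g h : acalg k X) (a : k).

Definition jacobian f g h :=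
  f ** g ** h - f ** h ** g - f ** (g ** h).

Lemma jacobianP a f f' g h :
  jacobian (a *: f + f') g h = a *: jacobian f g h + jacobian f' g h.
Proof.
rewrite /jacobian !acprodP; apply/malgP => w.
by rewrite !(mcoeffB, mcoeffD, mcoeffZ); ring.
Qed.

Lemma jacobian0 g h : jacobian 0 g h = 0.
Proof. by rewrite /jacobian !acprod0l !subrr. Qed.

Lemma jacobianCl f g h : jacobian g f h = - jacobian f g h.
Proof.
rewrite /jacobian (acprodC g f) (acprodC g (f ** h)) (acprodC f (g ** h)).
by rewrite acprodNl; apply/malgP => w; rewrite !(mcoeffB, mcoeffN); ring.
Qed.

Lemma jacobianCr f g h : jacobian f h g = - jacobian f g h.
Proof.
rewrite /jacobian (acprodC h g) acprodNr.
by apply/malgP => w; rewrite !(mcoeffB, mcoeffN); ring.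
Qed.

Lemma jacobianff f h : jacobian f f h = 0.
Proof.
rewrite /jacobian acprodff acprod0l sub0r (acprodC f (f ** h)).
by rewrite opprK addNr.
Qed.

(** Both sides expand into the monomials ((xy)z)t and (xy)(zt).  On the one hand
    the six jacobians with a product as first entry contain each ((xy)z)t once,
    signed by the permutation x, y, z, t, and their terms (xy)(zt) cancel in
    pairs.  On the other hand the four products of a jacobian with the
    remaining variable contain the same monomials ((xy)z)t. *)
Lemma jacobian_overlap (f g h l : acalg k X) :
  jacobian (f ** g) h l - jacobian f g h ** l =
  - jacobian (h ** l) f g - jacobian (f ** h) l g
  + jacobian (g ** l) f h - jacobian (f ** l) g h
  - jacobian (g ** h) f l - jacobian f g l ** h
  + jacobian f h l ** g - jacobian g h l ** f.
Proof.
rewrite /jacobian !(acprodDl, acprodNl).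
(* Each monomial is brought to one fixed order of its factors; after that,
   the identity is linear. *)
rewrite (acprodC (h ** l) (f ** g)) (acprodC (f ** h) (l ** g)).
rewrite (acprodC (g ** l) (f ** h)) (acprodC (f ** l) (g ** h)).
rewrite (acprodC l g) (acprodC f (g ** h)) (acprodC f (g ** l)).
rewrite (acprodC f (h ** l)) (acprodC g (h ** l)).
rewrite !(acprodNl, acprodNr, acprodDl, acprodDr).
rewrite (acprodC (g ** h) (f ** l)) (acprodC (g ** l) (f ** h)).
by apply/malgP => w; rewrite !(mcoeffD, mcoeffB, mcoeffN); ring.
Qed.

End Jacobian.

(** * Reduction to Hall words *)

Section HallReduction.
Context {k : fieldType} {disp : Order.disp_t} {X : orderType disp}.
Implicit Types (u v w : nword X) (f g h s : acalg k X) (a : k) (c : ctx X).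
Implicit Types (P Q : nword X -> Prop).

Local Notation S0 := (@S0 k disp X).

Lemma S0P f :
  S0 f <-> exists u v w : nword X,
    [/\ hall (val u), hall (val v) & hall (val w)] /\
    (v < u)%O /\ (w < v)%O /\ f = jacobian 'b_u 'b_v 'b_w.
Proof. by rewrite /jacobian basisw.unlock acprod.unlock. Qed.

(** All three monomials have the same length, and both factors of (uw)v and of
    u(vw) are smaller than [[uv]]. *)
Lemma jacobian_monic_at u v w : (v < u)%O -> (w < v)%O ->
  monic_at (jacobian 'b_u 'b_v 'b_w : acalg k X) (nbr (nbr u v) w).
Proof.
move=> lt_vu lt_wv; have lt_wu := lt_trans lt_wv lt_vu.
have lt_u := nbr_gtl lt_vu; have lt_v := lt_trans lt_vu lt_u.
have lt_w := lt_trans lt_wv lt_v.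
have le_wv := leq_nlen (ltW lt_wv); have le_vu := leq_nlen (ltW lt_vu).
rewrite /monic_at /jacobian !acprodUU (nmul_gt lt_vu) (nmul_gt lt_wu).
rewrite (nmul_gt lt_wv) !acprodUU (nmul_gt lt_w).
(* The leading terms cancel. *)
rewrite addrC -[X in _ + X]addrA addKr.
have lt_uw : (nbr u w < nbr u v)%O.
  by apply: nbr_lt; rewrite ?eqxx ?lt_wv ?orbT //; len_lia.
have lt_vw : (nbr v w < nbr u v)%O.
  by apply: nbr_lt; rewrite ?lt_vu //; len_lia.
apply: supp_inD; apply: supp_inN.
  apply: sub_supp_in (nmul_lt lt_uw lt_v lt_w _) => [x []//|].
  by rewrite !nlen_nbr //; len_lia.
apply: sub_supp_in (nmul_lt lt_u lt_vw lt_w _) => [x []//|].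
by rewrite !nlen_nbr //; len_lia.
Qed.

Lemma S0_monic s : S0 s -> Defs.monic s.
Proof.
move=> /S0P[u [v [w [_ [lt_vu [lt_wv ->]]]]]]; exists (nbr (nbr u v) w).
exact/monic_atP/jacobian_monic_at.
Qed.

Lemma sspan_jacobian P u v w :
    hall (val u) -> hall (val v) -> hall (val w) -> (v < u)%O -> (w < v)%O ->
    P (nbr (nbr u v) w) ->
  sspan S0 P (jacobian 'b_u 'b_v 'b_w).
Proof.
move=> hu hv hw lt_vu lt_wv; apply: (@sspan1 _ _ _ _ _ (Hole X)).
  by apply/S0P; exists u, v, w.
exists (nbr (nbr u v) w).
by have [] := monic_atP (jacobian_monic_at lt_vu lt_wv).
Qed.

Lemma hall_plug c (w : naword X) : hall (plug c w) -> hall w.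
Proof. by elim: c => //= [c IH v|v c IH] /and4P[_ hu hv _]; apply: IH. Qed.

(** A minimal subword that is not a Hall word violates condition (b), so it is
    [[[u1 u2] v]] with Hall words u1 > u2 > v. *)
Lemma nonhall_sword w :
  ~~ hall (val w) -> exists c s, S0 s /\ normal_sword c s w.
Proof.
case: w => w /= w_n; elim: w w_n => //= u IHu v IHv w_n.
have /and3P[u_n v_n lt_vu] := w_n; rewrite w_n /=.
have [hu /= nhv|nhu _] := boolP (hall u); last first.
  have [c [s [Ss [ls [lss e]]]]] := IHu u_n nhu.
  by exists (CtxL c v), s; split=> //; exists ls; rewrite /= e.
have [hv|{}nhv] := boolP (hall v); last first.
  have [c [s [Ss [ls [lss e]]]]] := IHv v_n nhv.
  by exists (CtxR u c), s; split=> //; exists ls; rewrite /= e.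
rewrite hv /= in nhv; case: u u_n hu {IHu} lt_vu w_n nhv => // u1 u2 u_n hu.
move=> lt_vu w_n; rewrite -ltNge => lt_vu2.
have /and3P[u1_n u2_n lt_u21] := u_n; have /and4P[_ hu1 hu2 _] := hu.
pose U1 := NWord u1_n; pose U2 := NWord u2_n; pose V := NWord v_n.
have lt_U : (U2 < U1)%O by rewrite ltEsub.
have lt_V : (V < U2)%O by rewrite ltEsub.
exists (Hole X), (jacobian 'b_U1 'b_U2 'b_V).
split; first by apply/S0P; exists U1, U2, V.
exists (nbr (nbr U1 U2) V).
split; first by have [] := monic_atP (jacobian_monic_at lt_U lt_V).
by rewrite /= [LHS]val_nbr ?val_nbr // ltEsub val_nbr.
Qed.

(** Congruence, modulo normal S0-words with leading word in [P], to a
    combination of Hall words in [P]. *)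
Definition hall_reducible P f :=
  exists2 g, supp_in (fun w => hall (val w) /\ P w) g & sspan S0 P (f - g).

Lemma hall_reducible_ind P Q f :
    supp_in P f ->
    (forall w, P w -> hall_reducible Q 'b_w) ->
  hall_reducible Q f.
Proof.
move=> Pf PQ; apply: (@acalg_ind _ _ _ f (hall_reducible Q)).
  by exists 0; [apply: supp_in0 | rewrite subrr; apply: sspan0].
move=> a w h wf [g Qg rg]; have [g' Qg' rg'] := PQ _ (Pf _ wf).
exists (a *: g' + g); first by apply: (supp_inD _ Qg); apply: supp_inZ.
by rewrite opprD addrACA -scalerBr; apply: (sspanD _ rg); apply: sspanZ.
Qed.

Lemma sub_hall_reducible P Q f :
  (forall w, P w -> Q w) -> hall_reducible P f -> hall_reducible Q f.
Proof.
move=> PQ [g Pg rg]; exists g; last exact: sub_sspan rg.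
by apply: sub_supp_in Pg => w [hw /PQ].
Qed.

Hypothesis X_wf : well_founded (fun x y : X => (x < y)%O).

Lemma hall_reducibleU w : hall_reducible (fun v => v <= w)%O 'b_w.
Proof.
elim: {w}(nword_wf X_wf w) => w _ IH.
have [hw|/nonhall_sword[c [s [Ss cs]]]] := boolP (hall (val w)).
  by exists 'b_w; [apply: supp_inU | rewrite subrr; apply: sspan0].
have t_w := normal_sword_monic_at S0_monic Ss cs.
have [g Pg rg]: hall_reducible (fun v => v <= w)%O (sword c s - 'b_w).
  apply: hall_reducible_ind t_w _ => v lt_vw.
  apply: sub_hall_reducible (IH _ lt_vw) => x le_xv.
  exact: le_trans (ltW lt_vw).
exists (- g); first exact: supp_inN.
have -> : 'b_w - - g = sword c s - (sword c s - 'b_w - g).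
  by rewrite opprB addrCA subKr opprK addrC.
by apply: sspanB rg; apply: sspan1 Ss cs _.
Qed.

End HallReduction.

(** * The composition at a proper overlap *)

Section Overlap.
Context {k : fieldType} {disp : Order.disp_t} {X : orderType disp}.
Hypothesis X_wf : well_founded (fun x y : X => (x < y)%O).
Variables a b c d : nword X.
Hypotheses (lt_ba : (b < a)%O) (lt_cb : (c < b)%O) (lt_dc : (d < c)%O).
Hypotheses (hall_a : hall (val a)) (hall_b : hall (val b)).
Hypotheses (hall_c : hall (val c)) (hall_d : hall (val d)).
Implicit Types (u v w : nword X) (f g h : acalg k X).

Local Notation S0 := (@S0 k disp X).
Local Notation ab := (nbr a b).
Local Notation abc := (nbr ab c).
Local Notation abcd := (nbr abc d).

Let lt_a : (a < ab)%O. Proof. exact: nbr_gtl. Qed.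
Let lt_b : (b < ab)%O. Proof. exact: lt_trans lt_ba lt_a. Qed.
Let lt_c : (c < ab)%O. Proof. exact: lt_trans lt_cb lt_b. Qed.
Let lt_d : (d < ab)%O. Proof. exact: lt_trans lt_dc lt_c. Qed.
Let lt_ab : (ab < abc)%O. Proof. exact: nbr_gtl. Qed.
Let lt_dabc : (d < abc)%O. Proof. exact: lt_trans lt_d lt_ab. Qed.
Let le_ba : (nlen b <= nlen a)%N. Proof. exact/leq_nlen/ltW. Qed.
Let le_cb : (nlen c <= nlen b)%N. Proof. exact/leq_nlen/ltW. Qed.
Let le_dc : (nlen d <= nlen c)%N. Proof. exact/leq_nlen/ltW. Qed.
Let nlen_ab : nlen ab = (nlen a + nlen b)%N. Proof. exact: nlen_nbr. Qed.
Let nlen_abc : nlen abc = (nlen a + nlen b + nlen c)%N.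
Proof. by rewrite nlen_nbr // nlen_ab. Qed.
Let nlen_abcd : nlen abcd = (nlen a + nlen b + nlen c + nlen d)%N.
Proof. by rewrite nlen_nbr // nlen_abc. Qed.

(** The hypotheses are symmetric in [u], [v], [w], so these may be sorted as
    u > v > w at the cost of a sign.  Then u < [ab] and the bound on the length
    of [uv] give [uv] < [[ab]c], and the bound on the total length gives
    [[uv]w] < [[[ab]c]d]. *)
Lemma sspan_jacobian_hall u v w :
    hall (val u) -> hall (val v) -> hall (val w) ->
    (u < ab)%O -> (v < ab)%O -> (w < ab)%O ->
    (nlen u + nlen v <= nlen abc)%N -> (nlen u + nlen w <= nlen abc)%N ->
    (nlen v + nlen w <= nlen abc)%N ->
    (nlen u + nlen v + nlen w <= nlen abcd)%N ->
  sspan S0 (fun x => x < abcd)%O (jacobian 'b_u 'b_v 'b_w).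
Proof.
pose G x y z :=
  sspan S0 (fun x => x < abcd)%O (jacobian 'b_x 'b_y 'b_z).
have swapl x y z : G x y z -> G y x z.
  by rewrite /G => Gxyz; rewrite jacobianCl; apply: sspanN.
have swapr x y z : G x y z -> G x z y.
  by rewrite /G => Gxyz; rewrite jacobianCr; apply: sspanN.
have G0 x y : G x x y by rewrite /G jacobianff; apply: sspan0.
have sorted x y z :
    hall (val x) -> hall (val y) -> hall (val z) -> (y < x)%O -> (z < y)%O ->
    (x < ab)%O -> (nlen x + nlen y <= nlen abc)%N ->
    (nlen x + nlen y + nlen z <= nlen abcd)%N -> G x y z.
  move=> hx hy hz lt_yx lt_zy lt_x le_xy le_xyz.
  have lt_zx : (z < nbr x y)%O.
    by apply: lt_trans (nbr_gtl lt_yx); apply: lt_trans lt_yx.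
  apply: sspan_jacobian => //; apply: nbr_lt => //.
    by rewrite (nlen_nbr lt_yx) -(nlen_nbr lt_dabc).
  by rewrite nbr_lt ?lt_x // -(nlen_nbr lt_c).
rewrite -/(G u v w) => hu hv hw lt_u lt_v lt_w le_uv le_uw le_vw le_uvw.
case: (ltgtP u v) => [lt_uv|lt_vu|<-]; last exact: G0.
  case: (ltgtP u w) => [lt_uw|lt_wu|<-]; last exact/swapr/G0.
    case: (ltgtP v w) => [lt_vw|lt_wv|<-]; last exact/swapl/swapr/G0.
      by apply/swapl/swapr/swapl; apply: sorted => //; len_lia.
    by apply/swapl/swapr; apply: sorted => //; len_lia.
  by apply/swapl; apply: sorted => //; len_lia.
case: (ltgtP u w) => [lt_uw|lt_wu|<-]; last exact/swapr/G0.
  by apply/swapr/swapl; apply: sorted => //; len_lia.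
case: (ltgtP v w) => [lt_vw|lt_wv|<-]; last exact/swapl/swapr/G0.
  by apply/swapr; apply: sorted => //; len_lia.
exact: sorted.
Qed.

Lemma sspan_jacobian_reducible f (r s : nword X) m :
    hall_reducible (below ab m) f -> hall (val r) -> hall (val s) ->
    (r < ab)%O -> (s < ab)%O -> (nlen r + nlen s <= nlen ab)%N ->
    (m + nlen r <= nlen abc)%N -> (m + nlen s <= nlen abc)%N ->
    (m + nlen r + nlen s <= nlen abcd)%N ->
  sspan S0 (fun x => x < abcd)%O (jacobian f 'b_r 'b_s).
Proof.
(* [g] is the Hall part of [f], and [f - g] its S0-part. *)
move=> [g gP rg] hr hs lt_r lt_s le_rs le_r le_s le.
rewrite -(subrK g f) -[f - g]scale1r jacobianP scale1r.
apply: sspanD; last first.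
  apply: (@acalg_ind _ _ _ g
    (fun h => sspan S0 (fun x => x < abcd)%O (jacobian h 'b_r 'b_s))).
    by rewrite jacobian0; apply: sspan0.
  move=> x u h ug IH; rewrite jacobianP; apply: (sspanD _ IH); apply: sspanZ.
  have [hu [lt_u le_u]] := gP _ ug.
  by apply: sspan_jacobian_hall => //; len_lia.
have mul u v : (u < ab)%O -> (v < ab)%O -> (m + nlen u <= nlen abc)%N ->
    (m + nlen u + nlen v <= nlen abcd)%N ->
  sspan S0 (fun x => x < abcd)%O ((f - g) ** 'b_u ** 'b_v).
  move=> lt_u lt_v le_u le_uv.
  have Pu := sspan_mul (@S0_monic _ _ _) rg lt_c lt_u.
  have {}Pu := Pu ltac:(by rewrite nlen_ab -nlen_abc).
  have Puv := sspan_mul (@S0_monic _ _ _) Pu lt_dabc (lt_trans lt_v lt_ab).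
  by apply: sub_sspan (Puv _) => [x []|]; len_lia.
apply: sspanB; first by apply: sspanB; apply: mul => //; len_lia.
rewrite acprodUU; apply: sspan_mulr (nmul_lt lt_r lt_s lt_c _) _.
  by len_lia.
move=> u [lt_u e_u].
have rg' : sspan S0 (below abc m) (f - g).
  by apply: sub_sspan rg => x [lt_x le_x]; split=> //; apply: lt_trans lt_ab.
have Pu := sspan_mul (@S0_monic _ _ _) rg' lt_dabc lt_u.
by apply: sub_sspan (Pu _) => [x []|]; len_lia.
Qed.

(** The words [p], [q], [r], [s] will be [a], [b], [c], [d] in another order. *)
Lemma sspan_jacobian_product (p q r s : nword X) :
    (q < p)%O -> (nbr p q < ab)%O -> hall (val r) -> hall (val s) ->
    (r < ab)%O -> (s < ab)%O -> (nlen r + nlen s <= nlen ab)%N ->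
    (nlen p + nlen q + nlen r <= nlen abc)%N ->
    (nlen p + nlen q + nlen s <= nlen abc)%N ->
    (nlen p + nlen q + nlen r + nlen s <= nlen abcd)%N ->
  sspan S0 (fun x => x < abcd)%O
    (jacobian ('b_p ** 'b_q) 'b_r 'b_s).
Proof.
move=> lt_qp lt_pq; rewrite acprodUU nmul_gt //.
apply: sspan_jacobian_reducible.
apply: sub_hall_reducible (hall_reducibleU X_wf _) => x le_x; split.
  exact: le_lt_trans lt_pq.
by rewrite -nlen_nbr // leq_nlen.
Qed.

Lemma sspan_jacobian_mul (u v w t : nword X) :
    hall (val u) -> hall (val v) -> hall (val w) -> (v < u)%O -> (w < v)%O ->
    (nbr u v < ab)%O || (nbr u v == ab) && (w < c)%O -> (t < abc)%O ->
    (nlen u + nlen v + nlen w <= nlen abc)%N ->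
    (nlen u + nlen v + nlen w + nlen t <= nlen abcd)%N ->
  sspan S0 (fun x => x < abcd)%O
    (jacobian 'b_u 'b_v 'b_w ** 'b_t).
Proof.
move=> hu hv hw lt_vu lt_wv lt_uv lt_t le_uvw le.
have lt_w : (w < nbr u v)%O.
  exact: lt_trans lt_wv (lt_trans lt_vu (nbr_gtl lt_vu)).
have P_uvw : sspan S0 (below abc (nlen u + nlen v + nlen w))
               (jacobian 'b_u 'b_v 'b_w).
  apply: sspan_jacobian => //; split; last by rewrite !nlen_nbr.
  by apply: nbr_lt; rewrite ?[nlen (nbr u v)]nlen_nbr //; len_lia.
have Pt := sspan_mul (@S0_monic _ _ _) P_uvw lt_dabc lt_t.
by apply: sub_sspan (Pt _) => [x []|]; len_lia.
Qed.

Lemma sspan_overlap :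
  sspan S0 (fun x => x < abcd)%O
    (jacobian ('b_a ** 'b_b) 'b_c 'b_d
     - jacobian 'b_a 'b_b 'b_c ** 'b_d).
Proof.
have lt_ca := lt_trans lt_cb lt_ba; have lt_da := lt_trans lt_dc lt_ca.
have lt_db := lt_trans lt_dc lt_cb.
have lt_nbr p q : (q < p)%O -> (nlen p + nlen q <= nlen a + nlen b)%N ->
    (p < a)%O || (p == a) && (q < b)%O -> (nbr p q < ab)%O.
  by move=> ? ? ?; apply: nbr_lt.
have lt_ac : (nbr a c < ab)%O.
  by apply: lt_nbr; rewrite ?eqxx ?lt_cb ?orbT //; len_lia.
have lt_ad : (nbr a d < ab)%O.
  by apply: lt_nbr; rewrite ?eqxx ?lt_db ?orbT //; len_lia.
have lt_bc : (nbr b c < ab)%O by apply: lt_nbr; rewrite ?lt_ba //; len_lia.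
have lt_bd : (nbr b d < ab)%O by apply: lt_nbr; rewrite ?lt_ba //; len_lia.
have lt_cd : (nbr c d < ab)%O by apply: lt_nbr; rewrite ?lt_ca //; len_lia.
have lt_cabc := lt_trans lt_c lt_ab; have lt_babc := lt_trans lt_b lt_ab.
have lt_aabc := lt_trans lt_a lt_ab.
rewrite jacobian_overlap; apply: sspanB; last first.
  by apply: sspan_jacobian_mul; rewrite ?lt_bc //; len_lia.
apply: sspanD; last by apply: sspan_jacobian_mul; rewrite ?lt_ac //; len_lia.
apply: sspanB; last first.
  by apply: sspan_jacobian_mul; rewrite ?eqxx ?lt_dc ?orbT //; len_lia.
do 2![apply: sspanB; last by apply: sspan_jacobian_product => //; len_lia].
apply: sspanD; last by apply: sspan_jacobian_product => //; len_lia.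
apply: sspanB; last by apply: sspan_jacobian_product => //; len_lia.
by apply: sspanN; apply: sspan_jacobian_product => //; len_lia.
Qed.

End Overlap.

Theorem theorem4p5 (k : fieldType) (disp : Order.disp_t) (X : orderType disp)
    (X_wf : well_founded (fun x y : X => (x < y)%O)) :
  groebner_shirshov_basis (@S0 k disp X).
Proof.
split=> [|f g W h]; first exact: S0_monic.
move=> /S0P[u [v [w [[hu hv hw] [lt_vu [lt_wv ->]]]]]].
move=> /S0P[p [q [r [[hp hq hr] [lt_qp [lt_rq ->]]]]]].
move=> -[lead_W [c [[l [lead_l e] ->]]]].
have [lead_f _] := monic_atP (@jacobian_monic_at k _ _ _ _ _ lt_vu lt_wv).
have [lead_g _] := monic_atP (@jacobian_monic_at k _ _ _ _ _ lt_qp lt_rq).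
have lt_w : (w < nbr u v)%O.
  exact: lt_trans lt_wv (lt_trans lt_vu (nbr_gtl lt_vu)).
have lt_r : (r < nbr p q)%O.
  exact: lt_trans lt_rq (lt_trans lt_qp (nbr_gtl lt_qp)).
rewrite (leading_uniq lead_W lead_f) in e *.
rewrite (leading_uniq lead_l lead_g) !val_nbr // in e.
have irred c' x : hall x -> plug c' (Br (Br (val p) (val q)) (val r)) <> x.
  move=> /[swap] <- /hall_plug /= /and4P[_ _ _].
  by rewrite leNgt -ltEsub lt_rq.
(* The mark is at the root, at the part [uv], or inside [u], [v] or [w]. *)
case: c e => [|[|c t|t c] x|x c] /= [].
- move=> /val_inj-> /val_inj-> /val_inj->; rewrite subrr.
  exact/sspan_trivial_mod/sspan0.
- move=> e_u /val_inj e_v e_x; rewrite e_x aceval_normal acmulE.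
  have e_pq : u = nbr p q by apply: val_inj; rewrite val_nbr.
  rewrite -e_v in hv lt_wv *; rewrite e_pq -nmul_gt // -acprodUU.
  exact/sspan_trivial_mod/sspan_overlap.
- by move=> /irred.
- by move=> _ /irred.
by move=> _ /irred.
Qed.
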